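(* Let $n\ge 3$ be an integer and let $A_1,\dots,A_n$ be real symmetric positive semidefinite matrices of the same size such that $A_1+\dots+A_n\preceq nI$. Then $$-I\preceq\widetilde{\mathbb{E}}_{i,j,k}A_iA_jA_k\preceq I.$$
   Context: For real symmetric matrices $A,B$ of the same size, $A\preceq B$ (Loewner order) means that $B-A$ is positive semidefinite. $I$ is the identity matrix. $\widetilde{\mathbb{E}}_{i,j,k}$ denotes the average over all ordered triples of distinct indices $1\le i,j,k\le n$, i.e. $$\widetilde{\mathbb{E}}_{i,j,k}A_iA_jA_k=\frac{1}{n(n-1)(n-2)}\sum_{\substack{1\le i,j,k\le n\\ i,j,k\text{ distinct}}}A_iA_jA_k .$$ *)

(* Defs.v *)
From mathcomp Require Import all_boot all_order all_algebra.
From mathcomp Require Import reals.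

Set Implicit Arguments.
Unset Strict Implicit.
Unset Printing Implicit Defensive.

Import Order.TTheory GRing.Theory Num.Theory.
Local Open Scope ring_scope.

Definition psdmx (R : realType) (m : nat) (A : 'M[R]_m) : Prop :=
  A \is symmetricmx /\ forall x : 'cV[R]_m, 0 <= (x^T *m A *m x) 0 0.

(* The Loewner order; since psdmx includes symmetry, knowing that one side is
   symmetric makes the other side symmetric too. *)
Definition loewner_le (R : realType) (m : nat) (A B : 'M[R]_m) : Prop :=
  psdmx (B - A).

(* The mean is meaningful for 3 <= n only: otherwise the sum is empty and the
   value is 0. *)
Definition distinct_triple_mean (R : realType) (n m : nat)
    (F : 'I_n -> 'I_n -> 'I_n -> 'M[R]_m) : 'M[R]_m :=
  (n%:R * (n%:R - 1) * (n%:R - 2%:R))^-1 *: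
    \sum_(i < n) \sum_(j < n) \sum_(k < n | [&& i != j, i != k & j != k])
      F i j k.

(* Main.v *)
(* Write S = sum A_i, M = S/n, D_i = A_i - M, Q = sum D_i^2, and let P be the
   sum of A_i A_j A_k over distinct triples.

   Upper bound: let K be the sum of (A_i - A_k) A_j (A_i - A_k) over distinct
   triples; K >= 0.  In P + K/n the cubes D_i^3 cancel, leaving
     (n-2) (n(n-1) M^3 - Q M - M Q + sum D_i M D_i),
   where sum D_i M D_i <= Q.  With c = n(n-1) we have 0 <= Q <= c, and
   (Q - c) (1 - M) (Q - c) >= 0 together with Q^2 <= c Q gives
   Q M + M Q >= Q - c (1 - M) >= Q - c (1 - M^3).

   Lower bound: with g = n/12, P is the sum over i of
     (S - g - A_i) A_i (S - g - A_i) + A_i (n - S) A_i + A_i (A_i - n/2 - g)^2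
   plus a polynomial of degree 2 in S that is at least -n(n-1)(n-2) for
   0 <= S <= n.  The shift g is needed only for n = 3: g = 0 gives the bound
   -n^3/4. *)

Require Import Defs.
From mathcomp Require Import all_boot all_order all_algebra.
From mathcomp Require Import reals ring lra.

Import Order.TTheory GRing.Theory Num.Theory.
Local Open Scope ring_scope.

Section Entries.
Context {R : realType} {m : nat}.
Implicit Types A B : 'M[R]_m.

Lemma addmxE A B i j : (A + B) i j = A i j + B i j.
Proof. by rewrite mxE. Qed.

Lemma oppmxE A i j : (- A) i j = - A i j.
Proof. by rewrite mxE. Qed.

Lemma scalemxE a A i j : (a *: A) i j = a * A i j.
Proof. by rewrite mxE. Qed.

End Entries.

(* For identities between noncommutative polynomials in matrices: once products
   are expanded into words, [field] treats each entry of a word as an atom. *)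
Ltac expand_mx :=
  rewrite ?(mulmxDl, mulmxDr, mulmxBl, mulmxBr, mulNmx, mulmxN, scalerDr,
    scalerBr, scalerN, mul1mx, mulmx1, =^~ scalemxAl, =^~ scalemxAr, mulmxA).
Ltac mx_field :=
  expand_mx; apply/matrixP => ? ?; rewrite ?(addmxE, oppmxE, scalemxE); field.

(** * Cone and congruence rules for positive semidefinite matrices *)

Section PositiveSemidefinite.
Context {R : realType} {m : nat}.
Implicit Types A B M Q X : 'M[R]_m.

Lemma symmetricmxP A : reflect (A^T = A) (A \is symmetricmx).
Proof.
rewrite is_hermitianmxE expr0 scale1r map_mx_id //.
by apply: (iffP eqP) => [{2}->|->].
Qed.

Lemma psdmx1 : psdmx (1%:M : 'M[R]_m).
Proof.
split=> [|x]; first by apply/symmetricmxP; rewrite trmx1.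
by rewrite mulmx1 mxE sumr_ge0 // => i _; rewrite mxE -expr2 sqr_ge0.
Qed.

Lemma psdmx0 : psdmx (0 : 'M[R]_m).
Proof.
split=> [|x]; first by apply/symmetricmxP; rewrite trmx0.
by rewrite mulmx0 mul0mx mxE.
Qed.

Lemma psdmxD {A B} : psdmx A -> psdmx B -> psdmx (A + B).
Proof.
move=> [/symmetricmxP sA pA] [/symmetricmxP sB pB]; split=> [|x].
  by apply/symmetricmxP; rewrite linearD /= sA sB.
by rewrite mulmxDr mulmxDl mxE addr_ge0.
Qed.

Lemma psdmxZ {a A} : 0 <= a -> psdmx A -> psdmx (a *: A).
Proof.
move=> a0 [/symmetricmxP sA pA]; split=> [|x].
  by apply/symmetricmxP; rewrite linearZ /= sA.
by rewrite -scalemxAr -scalemxAl mxE mulr_ge0.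
Qed.

Lemma psdmx_sum {I : Type} {r : seq I} {P : pred I} {F : I -> 'M[R]_m} :
  (forall i, P i -> psdmx (F i)) -> psdmx (\sum_(i <- r | P i) F i).
Proof. by move=> pF; elim/big_ind: _ => //; [exact: psdmx0|exact: @psdmxD]. Qed.

Lemma psdmx_congr {X A} : X^T = X -> psdmx A -> psdmx (X *m A *m X).
Proof.
move=> sX [/symmetricmxP sA pA]; split=> [|x].
  by apply/symmetricmxP; rewrite !trmx_mul sX sA mulmxA.
by have := pA (X *m x); rewrite trmx_mul sX !mulmxA.
Qed.

Lemma psdmx_sqr X : X^T = X -> psdmx (X *m X).
Proof. by move=> sX; have := psdmx_congr sX psdmx1; rewrite mulmx1. Qed.

Lemma psdmx_tr {A} : psdmx A -> A^T = A.
Proof. by case=> /symmetricmxP. Qed.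

Lemma tr_subZ1 {c A} : A^T = A -> (A - c *: 1%:M)^T = A - c *: 1%:M.
Proof. by move=> sA; rewrite linearB linearZ /= trmx1 sA. Qed.

(** [X] commutes with [c - X]; the two congruences in the proof add up to [c] times their product,
    so no square root is needed. *)
Lemma psdmx_mul_compl {c X} : 0 < c -> psdmx X -> psdmx (c *: 1%:M - X) ->
  psdmx (c *: X - X *m X).
Proof.
move=> c0 pX pcX; have c_neq0 : c != 0 by rewrite gt_eqF.
have -> : c *: X - X *m X = c^-1 *: (X *m (c *: 1%:M - X) *m X) +
    c^-1 *: ((c *: 1%:M - X) *m X *m (c *: 1%:M - X)) by mx_field.
have ic0 : 0 <= c^-1 by rewrite invr_ge0 ltW.
by apply: psdmxD; apply: psdmxZ => //; apply: psdmx_congr => //;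
  exact: psdmx_tr.
Qed.

Lemma psdmx_sub_cube {c M Q} : 0 < c -> psdmx M -> psdmx (1%:M - M) ->
  psdmx Q -> psdmx (c *: 1%:M - Q) ->
  psdmx (c *: (1%:M - M *m M *m M) + Q *m M + M *m Q - Q).
Proof.
(* Gives [1%:M - M] the shape [c *: 1%:M - X] of [psdmx_mul_compl] at [c = 1]. *)
move=> c0 pM; rewrite -(scale1r (1%:M - M)) scalerBr (scale1r M) => pM1 pQ pcQ.
have c_neq0 : c != 0 by rewrite gt_eqF.
(* The first three summands add up to [c (1 - M) + Q M + M Q - Q], the last two to [c (M - M^3)]. *)
have -> : c *: (1%:M - M *m M *m M) + Q *m M + M *m Q - Q =
    c^-1 *: ((Q - c *: 1%:M) *m (1 *: 1%:M - M) *m (Q - c *: 1%:M)) +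
    c^-1 *: (Q *m M *m Q) + c^-1 *: (c *: Q - Q *m Q) +
    c *: (1 *: M - M *m M) + c *: (M *m (1 *: 1%:M - M) *m M) by mx_field.
have ic0 : 0 <= c^-1 by rewrite invr_ge0 ltW.
have sM := psdmx_tr pM; have sQ := psdmx_tr pQ.
apply: psdmxD; last by apply: psdmxZ (ltW c0) (psdmx_congr sM pM1).
apply: psdmxD; last exact: psdmxZ (ltW c0) (psdmx_mul_compl ltr01 pM pM1).
apply: psdmxD; last exact: psdmxZ ic0 (psdmx_mul_compl c0 pQ pcQ).
apply: psdmxD; last exact: psdmxZ ic0 (psdmx_congr sQ pM).
exact: psdmxZ ic0 (psdmx_congr (tr_subZ1 sQ) pM1).
Qed.

End PositiveSemidefinite.

(** * Inclusion-exclusion over distinct triples *)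

Section DistinctTriples.
Context {V : zmodType} {n : nat}.
Implicit Types F : 'I_n -> 'I_n -> 'I_n -> V.

Definition distinct_triple_sum F : V :=
  \sum_(i < n) \sum_(j < n) \sum_(k < n | [&& i != j, i != k & j != k]) F i j k.

(** Each of the three pair collisions removes the full diagonal once, hence the correction by 2. *)
Lemma distinct_triple_sumE F :
  distinct_triple_sum F =
    \sum_i \sum_j \sum_k F i j k - \sum_i \sum_k F i i k -
    \sum_i \sum_j F i j i - \sum_i \sum_j F i j j + (\sum_i F i i i) *+ 2.
Proof.
rewrite -sumrMnl -3!sumrB -big_split; apply: eq_bigr => i _ /=.
(* The inner sum when [j != i]. Removing [G i] later supplies the terms [F i i k] and restores
   [F i i i] twice. *)
pose G j := \sum_k F i j k - F i j i - F i j j.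
have inner j : \sum_(k < n | [&& i != j, i != k & j != k]) F i j k =
    if j == i then 0 else G j.
  case: (j =P i) => [->|/eqP ji].
    by rewrite big_pred0 // => k; rewrite eqxx.
  have -> : G j = \sum_(k < n | (k != i) && (k != j)) F i j k.
    rewrite /G (bigD1 i) // (bigD1 j) //=.
    by rewrite -addrA -opprD addrA addrAC subrr add0r.
  by apply: eq_bigl => k; rewrite eq_sym ji /= !(eq_sym k).
under eq_bigr do rewrite inner.
rewrite (bigD1 i) //= eqxx add0r.
under eq_bigr => j /negPf ji do rewrite ji.
have -> : \sum_(j < n | j != i) G j = \sum_j G j - G i.
  by rewrite [in RHS](bigD1 i) //= addrAC subrr add0r.
have -> : \sum_j G j =
    \sum_j \sum_k F i j k - \sum_j F i j i - \sum_j F i j j by rewrite !sumrB.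
rewrite /G mulr2n !opprD !opprK !addrA.
by rewrite [LHS](ACl (1*4*2*3*5*6))%AC.
Qed.

End DistinctTriples.

(** * Sums of words in the [A i] *)

Section WordSums.
Context {R : realType} {m n : nat} (A : 'I_n -> 'M[R]_m).

Local Notation N := (n%:R : R).
Local Notation S := (\sum_i A i).
Local Notation T := (\sum_i A i *m A i).
Local Notation V := (\sum_i A i *m S *m A i).
Local Notation C := (\sum_i A i *m A i *m A i).

(** [Y] will be constant for the upper bound and [A] itself for the lower bound. *)
Lemma sum_congr_sub (B : 'M[R]_m) (Y : 'I_n -> 'M[R]_m) :
  \sum_i (B - A i) *m Y i *m (B - A i) =
    B *m (\sum_i Y i) *m B - B *m (\sum_i Y i *m A i) -
    (\sum_i A i *m Y i) *m B + \sum_i A i *m Y i *m A i.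
Proof.
rewrite !(mulmx_sumr, mulmx_suml) -!sumrB -big_split; apply: eq_bigr => i _.
by rewrite /=; mx_field.
Qed.

Lemma sum_congr_subC (B X : 'M[R]_m) :
  \sum_i (B - A i) *m X *m (B - A i) =
    N *: (B *m X *m B) - B *m X *m S - S *m X *m B +
    \sum_i A i *m X *m A i.
Proof.
rewrite (sum_congr_sub B (fun=> X)) sumr_const card_ord -scaler_nat.
by rewrite -mulmx_sumr -mulmx_suml -scalemxAr -scalemxAl !mulmxA.
Qed.

Lemma sum_triple_distinct :
  distinct_triple_sum (fun i j k => A i *m A j *m A k) =
    S *m S *m S - T *m S - V - S *m T + 2 *: C.
Proof.
rewrite distinct_triple_sumE scaler_nat; congr (_ - _ - _ - _ + _).
- rewrite !mulmx_suml; apply: eq_bigr => i _.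
  rewrite [A i *m _]mulmx_sumr mulmx_suml; apply: eq_bigr => j _.
  by rewrite mulmx_sumr.
- by rewrite mulmx_suml; apply: eq_bigr => i _; rewrite mulmx_sumr.
- by apply: eq_bigr => i _; rewrite mulmx_sumr mulmx_suml.
- rewrite mulmx_suml; apply: eq_bigr => i _; rewrite mulmx_sumr.
  by apply: eq_bigr => j _; rewrite mulmxA.
Qed.

(** Triples with [i = k] contribute 0; the collisions [j = i] and [j = k] contribute equally, by
    swapping [i] and [k]. *)
Lemma sum_triple_distinct_sub :
  distinct_triple_sum (fun i j k => (A i - A k) *m A j *m (A i - A k)) =
    (2 * (N - 1)) *: V - 2 *: (S *m S *m S) - (2 * N) *: C +
    2 *: (T *m S) + 2 *: (S *m T).
Proof.
have sum_sandwich X : \sum_i \sum_k (A i - A k) *m X *m (A i - A k) =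
    (2 * N) *: (\sum_i A i *m X *m A i) - 2 *: (S *m X *m S).
  under eq_bigr do rewrite sum_congr_subC.
  rewrite big_split /= !sumrB -scaler_sumr sumr_const card_ord -scaler_nat.
  by rewrite -!mulmx_suml -!mulmx_sumr; mx_field.
have sum_left : \sum_i \sum_k (A i - A k) *m A i *m (A i - A k) =
    N *: C - T *m S - S *m T + V.
  under eq_bigr do rewrite sum_congr_subC.
  rewrite big_split /= !sumrB -scaler_sumr -mulmx_suml exchange_big /=.
  congr (_ - _ - _ + _).
    by rewrite mulmx_sumr; apply: eq_bigr => i _; rewrite mulmxA.
  by apply: eq_bigr => i _; rewrite mulmx_sumr mulmx_suml.
have sum_right : \sum_i \sum_k (A i - A k) *m A k *m (A i - A k) =
    N *: C - T *m S - S *m T + V.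
  rewrite exchange_big -sum_left /=; do 2!apply: eq_bigr => ? _.
  by mx_field.
rewrite distinct_triple_sumE sum_left sum_right.
have -> : \sum_i \sum_j \sum_k (A i - A k) *m A j *m (A i - A k) =
    (2 * N) *: V - 2 *: (S *m S *m S).
  rewrite -sum_sandwich; apply: eq_bigr => i _; rewrite exchange_big /=.
  by apply: eq_bigr => k _; rewrite mulmx_sumr mulmx_suml.
have -> : \sum_i \sum_j (A i - A i) *m A j *m (A i - A i) = 0.
  by rewrite big1 // => i _; rewrite big1 // => j _; rewrite subrr mulmx0.
have -> : \sum_i (A i - A i) *m A i *m (A i - A i) = 0.
  by rewrite big1 // => i _; rewrite subrr mulmx0.
by rewrite mul0rn; mx_field.
Qed.

(** * The two bounds on [P] *)

Hypotheses (n_ge3 : (3 <= n)%N) (A_psd : forall i, psdmx (A i)).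
Hypothesis S_le : psdmx (N *: 1%:M - S).

Local Notation M := (N^-1 *: S).
Local Notation Q := (\sum_i (M - A i) *m (M - A i)).
Local Notation P := (distinct_triple_sum (fun i j k => A i *m A j *m A k)).

Let N_ge3 : 3 <= N. Proof. by rewrite (ler_nat _ 3). Qed.
Let N_gt0 : 0 < N. Proof. by have := N_ge3; lra. Qed.
Let N_neq0 : N != 0. Proof. by rewrite gt_eqF. Qed.
Let invN_ge0 : 0 <= N^-1. Proof. by rewrite invr_ge0 ltW. Qed.

Let S_psd : psdmx S. Proof. by apply: psdmx_sum. Qed.
Let M_psd : psdmx M. Proof. exact: psdmxZ. Qed.

Let M_le1 : psdmx (1%:M - M).
Proof.
have -> : 1%:M - M = N^-1 *: (N *: 1%:M - S) by mx_field.
exact: psdmxZ.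
Qed.

(** Needed for [A i *m A i <= N *: A i], which sums to [T <= N *: S] in [Q_le]. *)
Let A_le i : psdmx (N *: 1%:M - A i).
Proof.
have -> : N *: 1%:M - A i = (N *: 1%:M - S) + \sum_(j | j != i) A j.
  by rewrite (bigD1 i) //= opprD addrA addrNK.
by apply: psdmxD => //; apply: psdmx_sum.
Qed.

Let QE : Q = T - N^-1 *: (S *m S).
Proof.
have := sum_congr_subC M 1%:M.
rewrite (eq_bigr (fun i => (M - A i) *m (M - A i))) => [->|i _]; last first.
  by rewrite mulmx1.
rewrite [\sum_i A i *m _ *m _](eq_bigr (fun i => A i *m A i)) => [|i _].
  by mx_field.
by rewrite mulmx1.
Qed.

Let Q_psd : psdmx Q.
Proof.
apply: psdmx_sum => i _; apply: psdmx_sqr.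
by rewrite linearB /= !psdmx_tr.
Qed.

Let Q_le : psdmx ((N * (N - 1)) *: 1%:M - Q).
Proof.
have TS : psdmx (N *: S - T).
  rewrite scaler_sumr -sumrB; apply: psdmx_sum => i _.
  exact: psdmx_mul_compl.
(* Beyond [N S - T] there remains [N (1 - M) (N - 1 - M)], split by
   [N - 1 - M = (N - 2) + (1 - M)]. *)
have -> : (N * (N - 1)) *: 1%:M - Q = (N *: S - T) +
    (N * (N - 2)) *: (1%:M - M) + N *: ((1%:M - M) *m (1%:M - M)).
  by rewrite QE; mx_field.
apply: psdmxD; first apply: psdmxD => //; apply: psdmxZ => //.
- by rewrite mulr_ge0 ?(ltW N_gt0) //; have := N_ge3; lra.
- by apply: psdmx_sqr; exact: psdmx_tr.
Qed.

Lemma sum_triple_distinct_le :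
  psdmx ((N * (N - 1) * (N - 2)) *: 1%:M - P).
Proof.
pose K := distinct_triple_sum (fun i j k => (A i - A k) *m A j *m (A i - A k)).
have K_psd : psdmx K.
  do 3!(apply: psdmx_sum => ? _); apply: psdmx_congr => //.
  by rewrite linearB /= !psdmx_tr.
(* With [D_i = A i - M], [W] is [Q] minus the sum of [D_i M D_i]. *)
pose W := \sum_i (M - A i) *m (1%:M - M) *m (M - A i).
have W_psd : psdmx W.
  apply: psdmx_sum => i _; apply: psdmx_congr => //.
  by rewrite linearB /= !psdmx_tr.
have WE : W = N *: (M *m (1%:M - M) *m M) - M *m (1%:M - M) *m S -
    S *m (1%:M - M) *m M + (T - N^-1 *: V).
  rewrite /W sum_congr_subC; congr (_ + _).
  rewrite [N^-1 *: V]scaler_sumr -sumrB.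
  by apply: eq_bigr => i _; mx_field.
have c_gt0 : 0 < N * (N - 1) by rewrite mulr_gt0 //; have := N_ge3; lra.
have core := psdmx_sub_cube c_gt0 M_psd M_le1 Q_psd Q_le.
(* The weight [N^-1] cancels [C]: [P] contains [2 C] and [K] contains [- 2 N C]. *)
have -> : (N * (N - 1) * (N - 2)) *: 1%:M - P =
    (N^-1) *: K + (N - 2) *: W +
    (N - 2) *: ((N * (N - 1)) *: (1%:M - M *m M *m M) + Q *m M + M *m Q - Q).
  by rewrite QE WE sum_triple_distinct /K sum_triple_distinct_sub; mx_field.
by apply: psdmxD; first apply: psdmxD; apply: psdmxZ => //;
  have := N_ge3; lra.
Qed.

Lemma sum_triple_distinct_ge :
  psdmx (P + (N * (N - 1) * (N - 2)) *: 1%:M).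
Proof.
(* For [g = t N] the final identity has coefficients [(2 t^2 - 3 t + 1/4) N^3] on [1 - M] and
   [- (2 t^2 - t + 1/4) N^3] on [1]; [t = 1/12] keeps the first nonnegative and the second above
   [- 2/9 N^3], as [N = 3] demands. *)
pose g := N / 12.
pose L := \sum_i ((S - g *: 1%:M) - A i) *m A i *m ((S - g *: 1%:M) - A i).
have L_psd : psdmx L.
  apply: psdmx_sum => i _; apply: psdmx_congr => //.
  by rewrite linearB /= tr_subZ1 !psdmx_tr.
have LE := sum_congr_sub (S - g *: 1%:M) A.
(* Makes the coefficient [2 g - 2 h + N] of [T] in [L + H + U] vanish. *)
pose h := N / 2 + g.
pose H := \sum_i (h *: 1%:M - A i) *m A i *m (h *: 1%:M - A i).
have H_psd : psdmx H.
  apply: psdmx_sum => i _; apply: psdmx_congr => //.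
  by rewrite linearB linearZ /= trmx1 psdmx_tr.
have HE := sum_congr_sub (h *: 1%:M) A.
pose U := \sum_i A i *m (N *: 1%:M - S) *m A i.
have U_psd : psdmx U.
  by apply: psdmx_sum => i _; apply: psdmx_congr => //; exact: psdmx_tr.
have UE : U = N *: T - V.
  by rewrite /U scaler_sumr -sumrB; apply: eq_bigr => i _; mx_field.
(* The leftover [2 g S^2 - (g^2 + h^2) S] is [N^3 (M^2 / 6 - 25 M / 72)], expanded around
   [M = 1]. *)
have -> : P + (N * (N - 1) * (N - 2)) *: 1%:M =
    L + H + U + (N ^+ 3 / 6) *: ((1%:M - M) *m (1%:M - M)) +
    (N ^+ 3 / 72) *: (1%:M - M) +
    (N * (N - 1) * (N - 2) - N ^+ 3 * (13 / 72)) *: 1%:M.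
  by rewrite sum_triple_distinct UE /L /H LE HE /h /g; mx_field.
have N3_ge0 : 0 <= N ^+ 3 by rewrite exprn_ge0 // ltW.
apply: psdmxD; last first.
  (* At [N = 3] this reads [39/8 <= 6]. *)
  by apply: psdmxZ psdmx1; have := N_ge3; nra.
apply: psdmxD; last by apply: psdmxZ M_le1; have := N3_ge0; lra.
apply: psdmxD; first exact: psdmxD (psdmxD L_psd H_psd) U_psd.
apply: psdmxZ; first by have := N3_ge0; lra.
by apply: psdmx_sqr; exact: psdmx_tr.
Qed.

End WordSums.

(** * Normalization by the number of distinct triples *)

Theorem theorem2 (R : realType) (n m : nat) (A : 'I_n -> 'M[R]_m)
    (hn : (3 <= n)%N)
    (hpsd : forall i : 'I_n, psdmx (A i))
    (hsum : loewner_le (\sum_(i < n) A i) (n%:R *: 1%:M)) :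
  loewner_le (- 1%:M) (distinct_triple_mean (fun i j k => A i *m A j *m A k)) /\
  loewner_le (distinct_triple_mean (fun i j k => A i *m A j *m A k)) 1%:M.
Proof.
have n_ge3 : 3 <= n%:R :> R by rewrite (ler_nat _ 3).
have lower := sum_triple_distinct_ge A hn hpsd hsum.
have upper := sum_triple_distinct_le A hn hpsd hsum.
rewrite /loewner_le /distinct_triple_mean -/(distinct_triple_sum _) opprK.
move: lower upper; set P := distinct_triple_sum _ => lower upper.
set c := n%:R * _ * _ in lower upper *.
have c_gt0 : 0 < c by rewrite !mulr_gt0 //; lra.
have c_neq0 : c != 0 by rewrite gt_eqF.
have ic_ge0 : 0 <= c^-1 by rewrite invr_ge0 ltW.
split.
- have -> : c^-1 *: P + 1%:M = c^-1 *: (P + c *: 1%:M) by mx_field.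
  exact: psdmxZ.
- have -> : 1%:M - c^-1 *: P = c^-1 *: (c *: 1%:M - P) by mx_field.
  exact: psdmxZ.
Qed.
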